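(* Let $0 < k < n$ be an integer. Let $g, h : \mathcal{G}_{n-k,n} \to [0,\infty)$ be a pair of continuous functions in $L^1(\mathcal{G}_{n-k,n})$ such that $\mathcal{R}_{n-k}^*g(x) \leq \mathcal{R}_{n-k}^*h(x)$ holds for all $x \in \mathbb{R}^n$. Then \[ \|g\|_{L^1(\mathcal{G}_{n-k,n})} \leq\|h\|_{L^1(\mathcal{G}_{n-k,n})}. \]
   Context: $G_{n-k,n}$ is the Grassmannian of $(n-k)$-dimensional linear subspaces of $\mathbb{R}^n$ with Haar measure $\nu_{n-k}$ of total mass $|S^{k-1}||S^{n-k-1}|/|S^{n-1}|$. $\mathcal{G}_{n-k,n}$ is the manifold of $(n-k)$-dimensional affine subspaces of $\mathbb{R}^n$; its elements are written $(H,z)$, with $H\in G_{n-k,n}$, $z\in H^\perp$, representing $H+z$. $\|g\|_{L^1(\mathcal{G}_{n-k,n})}=\int_{G_{n-k,n}}\int_{H^\perp}|g(H,z)|\,dz\,d\nu_{n-k}(H)$. The dual $(n-k)$-dimensional Radon transform is $\mathcal{R}_{n-k}^*g(x)=\int_{G_{n-k,n}}g(H,P_{H^\perp}(x))\,d\nu_{n-k}(H)$, $x\in\mathbb{R}^n$, with $P_{H^\perp}$ the orthogonal projection onto $H^\perp$. *)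

(* Defs.v *)
From HB Require Import structures.
From mathcomp Require Import all_boot all_order all_algebra.
From mathcomp Require Import all_classical all_reals all_analysis.

Set Implicit Arguments.
Unset Strict Implicit.
Unset Printing Implicit Defensive.

Import Order.TTheory GRing.Theory Num.Theory.
Import numFieldNormedType.Exports.

Local Open Scope classical_set_scope.
Local Open Scope ring_scope.

Section tuple_pair.
Variables (R : realType) (m : nat).

Definition tuple_of_pair (p : measurableTypeR R * m.-tuple (measurableTypeR R)) :
  m.+1.-tuple (measurableTypeR R) := [tuple of p.1 :: p.2].

Definition pair_of_tuple (t : m.+1.-tuple (measurableTypeR R)) :
  measurableTypeR R * m.-tuple (measurableTypeR R) :=
  (thead t, [tuple of behead t]).

Lemma tuple_of_pairK : cancel tuple_of_pair pair_of_tuple.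
Proof. by move=> [x t]; congr pair; apply/val_inj. Qed.

Lemma pair_of_tupleK : cancel pair_of_tuple tuple_of_pair.
Proof. by move=> t; rewrite [RHS]tuple_eta; apply/val_inj. Qed.

Lemma measurable_tuple_of_pair : measurable_fun setT tuple_of_pair.
Proof. exact: measurable_cons. Qed.

Lemma measurable_pair_of_tuple : measurable_fun setT pair_of_tuple.
Proof.
apply/measurable_fun_pairP; split; last exact: measurable_behead.
exact: (@measurable_tnth _ _ m.+1 ord0).
Qed.

End tuple_pair.

Section lebesgue_tupleS.
Variables (R : realType) (m : nat).
Variable mu : {sigma_finite_measure set (m.-tuple (measurableTypeR R)) -> \bar R}.
Local Open Scope ereal_scope.

Definition lebesgue_tupleS : set (m.+1.-tuple (measurableTypeR R)) -> \bar R :=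
  pushforward (@lebesgue_measure R \x mu) (@tuple_of_pair R m).

Let mpre A : measurable A -> measurable (@tuple_of_pair R m @^-1` A).
Proof.
move=> mA; rewrite -[X in measurable X]setTI; exact: measurable_tuple_of_pair.
Qed.

Let lebesgue_tupleS0 : lebesgue_tupleS set0 = 0.
Proof. by rewrite /lebesgue_tupleS /pushforward preimage_set0 measure0. Qed.

Let lebesgue_tupleS_ge0 A : 0 <= lebesgue_tupleS A.
Proof. by rewrite /lebesgue_tupleS /pushforward measure_ge0. Qed.

Let lebesgue_tupleS_sigma_additive : semi_sigma_additive lebesgue_tupleS.
Proof.
move=> F mF tF mUF; rewrite /lebesgue_tupleS /pushforward preimage_bigcup.
apply: measure_semi_sigma_additive.
- by move=> i; exact: mpre.
- apply/trivIsetP => /= i j _ _ ij; rewrite -preimage_setI.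
  by move/trivIsetP : tF => /(_ _ _ _ _ ij) ->//; rewrite preimage_set0.
- by rewrite -preimage_bigcup; exact: mpre.
Qed.

HB.instance Definition _ := isMeasure.Build _ _ _ lebesgue_tupleS
  lebesgue_tupleS0 lebesgue_tupleS_ge0 lebesgue_tupleS_sigma_additive.

Let lebesgue_tupleS_sigma_finite : sigma_finite setT lebesgue_tupleS.
Proof.
have /sigma_finiteP[F [FT ndF Foo]] := sigma_finiteT (@lebesgue_measure R).
have /sigma_finiteP[G [GT ndG Goo]] := sigma_finiteT mu.
exists (fun i => @pair_of_tuple R m @^-1` (F i `*` G i)).
  rewrite -preimage_bigcup (_ : \bigcup_i _ = setT) ?preimage_setT//.
  rewrite -setXTT FT GT predeqE => -[x y]; split=> [[i _ []/= ? ?]|].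
    by split; exists i.
  move=> [/= [i _ Fx] [j _ Gy]]; exists (maxn i j) => //; split.
  - by move: x Fx; exact/subsetPset/ndF/leq_maxl.
  - by move: y Gy; exact/subsetPset/ndG/leq_maxr.
move=> i; have [mF Fi] := Foo i; have [mG Gi] := Goo i; split.
  rewrite -[X in measurable X]setTI; apply: measurable_pair_of_tuple => //.
  exact: measurableX.
rewrite /lebesgue_tupleS /pushforward -comp_preimage.
rewrite (_ : _ \o _ = id) ?preimage_id; last exact/funext/tuple_of_pairK.
by rewrite product_measure1E// lte_mul_pinfty// ge0_fin_numE.
Qed.

HB.instance Definition _ := Measure_isSigmaFinite.Build _ _ _ lebesgue_tupleS
  lebesgue_tupleS_sigma_finite.

End lebesgue_tupleS.

(* Lebesgue measure on R^m, as the m-fold product of the one on R, along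
   R^(m+1) = R x R^m. *)
Fixpoint lebesgue_tuple (R : realType) (m : nat) :
    {sigma_finite_measure set (m.-tuple (measurableTypeR R)) -> \bar R} :=
  match m with
  | 0 => \d_([tuple] : 0.-tuple (measurableTypeR R))
  | m'.+1 => lebesgue_tupleS (lebesgue_tuple R m')
  end.

(* Spherical measure on S^(m-1), in its cone form:
   sigma(A) = m * vol {t a | 0 <= t <= 1, a in A}. *)
Section sphere.
Variables (R : realType) (m : nat).
Local Notation T := (m.-tuple (measurableTypeR R)).

Definition sphere : set T := [set x | \sum_(i < m) tnth x i ^+ 2 = 1].

Definition cone (A : set T) : set T :=
  [set x | exists t : R, exists2 a : T, A a &
     0 <= t <= 1 /\ forall i, tnth x i = t * tnth a i].

Definition sphere_measure (A : set T) : \bar R :=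
  (m%:R%:E * lebesgue_tuple R m (cone A))%E.

Definition sphere_area : R := fine (sphere_measure sphere).

End sphere.

Section euclidean.
Variables (R : realType) (n : nat).

Definition dotv (u v : 'rV[R]_n) : R := (u *m v^T) 0 0.

Let dotv_bilinear : bilinear_for
    (GRing.Scale.Law.clone _ _ ( *%R ) _)
    (GRing.Scale.Law.clone _ _ (idfun \; *%R ) _) dotv.
Proof.
split=> [v|u] a x y /=; rewrite /dotv.
  by rewrite mulmxDl -scalemxAl !mxE.
by rewrite linearP/= mulmxDr -scalemxAr !mxE.
Qed.

HB.instance Definition _ :=
  bilinear_isBilinear.Build R _ _ _ _ _ dotv dotv_bilinear.

Let dotv_sym u v : dotv u v = (-1) ^+ false * idfun (dotv v u).
Proof.
by rewrite expr0 mul1r /dotv /= !mxE; apply: eq_bigr => i _; rewrite !mxE mulrC.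
Qed.

HB.instance Definition _ := isHermitianSesquilinear.Build R _ _ _ dotv dotv_sym.

Let dotv_gt0 u : u != 0 -> 0 < dotv u u.
Proof.
move=> u0; have [i ui0] : exists i, u 0 i != 0.
  by apply/existsP; apply: contraNT u0 => /existsPn u0; apply/eqP/rowP => i;
    rewrite mxE; apply/eqP/negPn/u0.
rewrite /dotv mxE (bigD1 i)//= mxE -expr2 ltr_pwDl ?exprn_even_gt0//.
by apply: sumr_ge0 => j _; rewrite mxE -expr2 sqr_ge0.
Qed.

HB.instance Definition _ := isDotProduct.Build _ _ dotv dotv_gt0.

Implicit Types W : {vspace 'rV[R]_n}.

Definition orthc W : {vspace 'rV[R]_n} := orthov dotv W.

Definition oproj W : 'End('rV[R]_n) := daddv_pi W (orthc W).

(* [vsproj W] alone projects along a complement of W that need not be its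
   orthogonal one. *)
Definition oproj_sub W (x : 'rV[R]_n) : subvs_of W := vsproj W (oproj W x).

Definition onb W : (\dim W).-tuple 'rV[R]_n :=
  xget (vbasis W)
    [set b : (\dim W).-tuple 'rV[R]_n | basis_of W b && orthonormal dotv b].

Definition subspace_point W (t : (\dim W).-tuple (measurableTypeR R)) :
  subvs_of W := \sum_(i < \dim W) tnth t i *: vsproj W (tnth (onb W) i).

(* Integral over W for the (\dim W)-dimensional Lebesgue measure, in the
   coordinates of an orthonormal basis (the choice of which is irrelevant). *)
Definition subspace_integral W (f : subvs_of W -> \bar R) : \bar R :=
  (\int[lebesgue_tuple R (\dim W)]_t f (subspace_point t))%E.

End euclidean.

(* G_{n-k,n}: the parameter k is the codimension, so that the type is
   inhabited for all n and k, as required of a measurable type. *)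
Definition grassmannian (R : realType) (n k : nat) : Type :=
  {H : {vspace 'rV[R]_n} | \dim H == (n - k)%N}.

Section grassmannian.
Variables (R : realType) (n k : nat).
Local Notation Gr := (grassmannian R n k).

HB.instance Definition _ := Choice.on Gr.

Let grassmannian_inhabited : exists H : {vspace 'rV[R]_n}, \dim H == (n - k)%N.
Proof.
pose X := take (n - k) (vbasis {:'rV[R]_n}); exists <<X>>%VS.
have : free X.
  have := basis_free (vbasisP {:'rV[R]_n}).
  by rewrite -(cat_take_drop (n - k) (vbasis _)) => /catl_free.
move=> /eqP ->; rewrite size_takel// size_tuple dimvf /dim /= mul1n.
exact: leq_subr.
Qed.

HB.instance Definition _ := isPointed.Build Gr
  (exist _ (xchoose grassmannian_inhabited) (xchooseP grassmannian_inhabited)).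

(* The manifold topology is the one induced by the embedding of G_{n-k,n}
   in the matrices which sends H to the orthogonal projection P_H. *)
Definition grassmannian_proj (H : Gr) : 'M[R]_n := lin1_mx (oproj (val H)).

HB.instance Definition _ :=
  Topological.copy Gr (initial_topology grassmannian_proj).

HB.instance Definition _ :=
  Measurable.copy Gr (g_sigma_algebraType (@open Gr)).

(* The orthogonal group acts on row vectors from the right. *)
Definition rotate (U : 'M[R]_n) (A : set Gr) : set Gr :=
  [set H | exists2 H', A H' & val H = (linfun (mulmxr U) @: val H')%VS].

(* Haar measure: the rotation invariant Borel measure of the given mass. *)
Definition haar_measure (nu : {measure set Gr -> \bar R}) : Prop :=
  (forall (U : 'M[R]_n) (A : set Gr),
     U *m U^T = 1%:M -> measurable A -> nu (rotate U A) = nu A) /\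
  nu setT = (sphere_area R k * sphere_area R (n - k) / sphere_area R n)%:E.

(* The pairs (H, z) with z orthogonal to H stand for H + z; the topology is
   induced by the product G_{n-k,n} x R^n. *)
Definition affine_grassmannian : Type :=
  set_type [set p : Gr * 'rV[R]_n | p.2 \in orthc (val p.1)].

HB.instance Definition _ := Topological.on affine_grassmannian.

Definition affine_sub (H : Gr) (z : subvs_of (orthc (val H))) :
  affine_grassmannian := exist _ (H, val z) (mem_set (subvsP z)).

Variable nu : {measure set Gr -> \bar R}.
Implicit Type g : affine_grassmannian -> R.

Definition L1_norm g : \bar R :=
  (\int[nu]_H subspace_integral
     (fun z : subvs_of (orthc (val H)) => `|g (affine_sub z)|%:E))%E.

Definition dual_radon g (x : 'rV[R]_n) : \bar R :=
  (\int[nu]_H (g (affine_sub (oproj_sub (orthc (val H)) x)))%:E)%E.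

End grassmannian.

(* Main.v *)
From HB Require Import structures.
Require Import Defs.
From mathcomp Require Import all_boot all_order all_algebra.
From mathcomp Require Import all_classical all_reals all_analysis.
From mathcomp Require Import measurable_realfun ring lra.

(* Integrate the hypothesis against the Gaussian exp(-|x|^2 / (2 s^2)) on R^n.
   By Tonelli and the orthogonal splitting x = y + z with y in H and z in
   H^perp, the integral of (R^* g) exp(-|x|^2 / (2 s^2)) is a constant c(s),
   the same for g and h, times the integral of g(H, z) exp(-|z|^2 / (2 s^2))
   over all (H, z). Divide by c(s) and let s tend to infinity: by monotone
   convergence both sides tend to the L^1 norms.

   The splitting of Lebesgue measure on R^n along H and H^perp follows from the
   uniqueness of Haar measure up to a constant, which is computed with the same
   Gaussian. *)

Set Implicit Arguments.
Unset Strict Implicit.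
Unset Printing Implicit Defensive.

Import Order.TTheory GRing.Theory Num.Theory.
Import numFieldNormedType.Exports.

Local Open Scope classical_set_scope.
Local Open Scope ring_scope.

(** * Reflections of Lebesgue measure *)

Section tuple_reflection.
Variable R : realType.
Implicit Types m : nat.
Local Notation T m := (m.-tuple (measurableTypeR R)).

Definition tuple_sub m (a x : T m) : T m := [tuple tnth a i - tnth x i | i < m].

Lemma tnth_tuple_sub m (a x : T m) i :
  tnth (tuple_sub a x) i = tnth a i - tnth x i.
Proof. by rewrite tnth_mktuple. Qed.

Lemma measurable_tuple_sub d (Y : measurableType d) m (f g : Y -> T m) :
  measurable_fun setT f -> measurable_fun setT g ->
  measurable_fun setT (fun y => tuple_sub (f y) (g y)).
Proof.
move=> mf mg; apply/measurable_fun_tnthP => i.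
rewrite (_ : _ \o _ = (fun y => tnth (f y) i - tnth (g y) i)); last first.
  by apply/funext => y /=; rewrite tnth_tuple_sub.
by apply: measurable_funB;
  exact: (measurableT_comp (measurable_tnth (T := measurableTypeR R) i)).
Qed.

Lemma tuple_sub_cons m (x y : measurableTypeR R) (s t : T m) :
  tuple_sub (tuple_of_pair (x, s)) (tuple_of_pair (y, t)) =
  tuple_of_pair (x - y : measurableTypeR R, tuple_sub s t).
Proof.
apply/eq_from_tnth => i; rewrite tnth_tuple_sub.
by case: (unliftP ord0 i) => [j|] ->; rewrite ?tnthS ?tnth0// tnth_tuple_sub.
Qed.

Local Open Scope ereal_scope.

Lemma ge0_integral_lebesgue_tupleS m (f : T m.+1 -> \bar R) :
  measurable_fun setT f -> (forall x, 0 <= f x) ->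
  \int[lebesgue_tuple R m.+1]_x f x =
  \int[lebesgue_measure]_x \int[lebesgue_tuple R m]_t f (tuple_of_pair (x, t)).
Proof.
move=> mf f0; rewrite /= /lebesgue_tupleS.
rewrite ge0_integral_pushforward//; last exact: measurable_tuple_of_pair.
rewrite preimage_setT fubini_tonelli1//; last by move=> x; exact: f0.
by apply: measurableT_comp => //; exact: measurable_tuple_of_pair.
Qed.

(** Lebesgue measure is determined by its values on half-open intervals. The reflection pulls []b,
    c]] back to an interval of the same length, closed at the other end. *)
Lemma lebesgue_measure_reflection (a : R) (A : set R) : measurable A ->
  pushforward lebesgue_measure
    (fun x : measurableTypeR R => a - x : measurableTypeR R)%R A =
  lebesgue_measure A.
Proof.
move=> mA; apply/esym.
have mphi : measurable_fun setT
    (fun x : measurableTypeR R => a - x : measurableTypeR R)%R.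
  exact: measurable_funB.
pose phi : {mfun measurableTypeR R >-> measurableTypeR R} :=
  HB.pack (fun x : measurableTypeR R => a - x : measurableTypeR R)%R
    (isMeasurableFun.Build _ _ _ _ _ mphi).
apply: (@lebesgue_measure_unique R (pushforward lebesgue_measure phi)) => //.
move=> _ [[b c]] _ <-.
transitivity (lebesgue_measure `[(a - c)%R, (a - b)%R[%classic).
  rewrite !lebesgue_measure_itv/= !lte_fin ltrD2l ltrN2.
  by case: ifP => // _; rewrite -!EFinB; congr EFin; ring.
rewrite /= /pushforward; congr (lebesgue_measure _).
apply/seteqP; split => x /=; rewrite !in_itv/= => /andP[h1 h2]; apply/andP.
  by split; lra.
by split; lra.
Qed.

Lemma ge0_integral_lebesgue_reflection (a : R)
    (f : measurableTypeR R -> \bar R) :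
  measurable_fun setT f -> (forall x, 0 <= f x) ->
  \int[lebesgue_measure]_x f (a - x)%R = \int[lebesgue_measure]_x f x.
Proof.
move=> mf f0.
have mphi : measurable_fun setT
    (fun x : measurableTypeR R => a - x : measurableTypeR R)%R.
  exact: measurable_funB.
transitivity (\int[pushforward lebesgue_measure
    (fun x : measurableTypeR R => a - x : measurableTypeR R)%R]_x f x).
  by rewrite ge0_integral_pushforward.
by apply: eq_measure_integral => A mA _; exact: lebesgue_measure_reflection.
Qed.

(** Induction on the dimension: Tonelli splits off the first coordinate, and the reflection acts on
    each coordinate separately. *)
Lemma ge0_integral_tuple_reflection m (a : T m) (f : T m -> \bar R) :
  measurable_fun setT f -> (forall x, 0 <= f x) ->
  \int[lebesgue_tuple R m]_x f (tuple_sub a x) = \int[lebesgue_tuple R m]_x f x.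
Proof.
elim: m => [|m IH] in a f * => mf f0.
  by apply: eq_integral => x _; rewrite (tuple0 x) (tuple0 (tuple_sub _ _)).
rewrite !ge0_integral_lebesgue_tupleS//; last first.
  by apply: measurableT_comp => //; exact: measurable_tuple_sub.
rewrite -(pair_of_tupleK a); case: (pair_of_tuple a) => b s.
under eq_integral.
  move=> x _.
  under eq_integral do rewrite tuple_sub_cons.
  rewrite (IH s
    (fun t => f (tuple_of_pair ((b - x : measurableTypeR R)%R, t))))//; last first.
    apply: measurableT_comp => //.
    apply: (measurableT_comp (@measurable_tuple_of_pair R m)).
    exact: pair1_measurable.
  over.
rewrite (ge0_integral_lebesgue_reflection b
  (f := fun x : measurableTypeR R =>
    \int[lebesgue_tuple R m]_t f (tuple_of_pair (x, t))))//.
  apply: (measurable_fun_fubini_tonelli_F (fun z => f (tuple_of_pair z))) => //.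
  by apply: measurableT_comp => //; exact: measurable_tuple_of_pair.
by move=> x; exact: integral_ge0.
Qed.

(* Uniqueness of Haar measure, for the pair [mu], [pushforward rho phi]; it is
   convenient that [x |-> a - x] encodes both translations and symmetry. *)
Lemma reflection_invariant_proportional m
    (mu : {sigma_finite_measure set T m -> \bar R})
    d (Y : measurableType d) (rho : {sigma_finite_measure set Y -> \bar R})
    (phi : Y -> T m) (f g : T m -> \bar R) :
  measurable_fun setT phi ->
  (forall a (u : T m -> \bar R), measurable_fun setT u -> (forall x, 0 <= u x) ->
    \int[mu]_x u (tuple_sub a x) = \int[mu]_x u x) ->
  (forall a (u : T m -> \bar R), measurable_fun setT u -> (forall x, 0 <= u x) ->
    \int[rho]_y u (tuple_sub a (phi y)) = \int[rho]_y u (phi y)) ->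
  measurable_fun setT f -> (forall x, 0 <= f x) ->
  measurable_fun setT g -> (forall x, 0 <= g x) ->
  (\int[mu]_x f x) * (\int[rho]_y g (phi y)) =
  (\int[rho]_y f (phi y)) * (\int[mu]_x g x).
Proof.
move=> mphi mu_refl rho_refl mf f0 mg g0.
pose o : T m := [tuple 0%R | i < m].
have subr0 (x y : T m) : tuple_sub (tuple_sub x y) x = tuple_sub o y.
  by apply/eq_from_tnth => i; rewrite !tnth_tuple_sub tnth_mktuple addrAC subrr.
(* For fixed [y], [x] is reflected at [phi y], which couples the two variables in one double
   integral. *)
transitivity (\int[rho]_y \int[mu]_x
    (f (tuple_sub (phi y) x) * g (phi y))).
  rewrite muleC -ge0_integralZr//; last 2 first.
  - exact: measurableT_comp.
  - exact: integral_ge0.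
  apply: eq_integral => y _.
  rewrite (mu_refl (phi y) (fun x => f x * g (phi y))); last 2 first.
  - by apply: emeasurable_funM.
  - by move=> x; rewrite mule_ge0.
  by rewrite ge0_integralZr// muleC.
rewrite -(fubini_tonelli
  (fun z => f (tuple_sub (phi z.2) z.1) * g (phi z.2)))//; last 2 first.
- apply: emeasurable_funM.
    apply: measurableT_comp => //; apply: measurable_tuple_sub => //.
    exact: measurableT_comp.
  by apply: measurableT_comp => //; exact: measurableT_comp.
- by move=> z; rewrite mule_ge0.
(* With [x] fixed, reflecting [phi y] at [x] moves the dependence on [x] from [f] to [g]. *)
transitivity (\int[mu]_x \int[rho]_y
    (f (tuple_sub o (phi y)) * g (tuple_sub x (phi y)))).
  apply: eq_integral => x _ /=.
  rewrite -(rho_refl x (fun z => f (tuple_sub z x) * g z)); last 2 first.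
  - by apply: emeasurable_funM => //; apply: measurableT_comp => //;
      exact: measurable_tuple_sub.
  - by move=> z; rewrite mule_ge0.
  by apply: eq_integral => y _; rewrite subr0.
rewrite (fubini_tonelli (fun z => f (tuple_sub o (phi z.2)) *
    g (tuple_sub z.1 (phi z.2))))//; last 2 first.
- by apply: emeasurable_funM; apply: measurableT_comp => //;
    apply: measurable_tuple_sub => //; exact: measurableT_comp.
- by move=> z; rewrite mule_ge0.
rewrite -(rho_refl o f mf f0) -ge0_integralZr//; last 2 first.
- apply: measurableT_comp => //; exact: measurable_tuple_sub.
- exact: integral_ge0.
apply: eq_integral => y _ /=.
rewrite ge0_integralZl//; last first.
  by apply: measurableT_comp => //; exact: measurable_tuple_sub.
congr (_ * _).
(* The translation by [phi y] is undone by two reflections, the first at [phi y] and the second at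
   the origin [o]. *)
rewrite -(mu_refl (phi y) (fun x => g (tuple_sub x (phi y))))//; last first.
  by apply: measurableT_comp => //; exact: measurable_tuple_sub.
by under eq_integral do rewrite subr0; exact: mu_refl.
Qed.

End tuple_reflection.

(** * Gaussian weights *)

Section gauss_weight.
Variable R : realType.
Implicit Types (m : nat) (s : R).
Local Notation T m := (m.-tuple (measurableTypeR R)).

(** Left unnormalised, so that it increases to 1 pointwise as [s] grows; in dimension one it is
    [normal_fun 0 s]. *)
Definition gauss_weight s m (x : T m) : R :=
  expR (- (\sum_(i < m) tnth x i ^+ 2) / (s ^+ 2 *+ 2)).

Lemma gauss_weight_ge0 s m (x : T m) : 0 <= gauss_weight s x.
Proof. exact: expR_ge0. Qed.

Lemma measurable_gauss_weight s m :
  measurable_fun setT (fun x : T m => gauss_weight s x).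
Proof.
rewrite /gauss_weight; apply: measurableT_comp => //.
apply: measurable_funM => //; apply: measurableT_comp => //.
apply: measurable_sum => i.
by apply: measurable_funX; exact: measurable_tnth.
Qed.

Lemma gauss_weight_cons s m (z : measurableTypeR R * T m) :
  gauss_weight s (tuple_of_pair z) = normal_fun 0 s z.1 * gauss_weight s z.2.
Proof.
case: z => x t; rewrite /gauss_weight /normal_fun -expRD big_ord_recl tnth0.
under eq_bigr do rewrite tnthS.
by rewrite subr0 -mulrDl -opprD.
Qed.

Lemma le_gauss_weight s s' m (x : T m) : 0 < s -> s <= s' ->
  gauss_weight s x <= gauss_weight s' x.
Proof.
move=> s0 ss'; rewrite ler_expR !mulNr lerN2 ler_wpM2l//.
  by apply: sumr_ge0 => i _; exact: sqr_ge0.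
have s'0 := lt_le_trans s0 ss'.
by rewrite lef_pV2 ?posrE ?pmulrn_lgt0 ?exprn_gt0// lerMn2r/= ler_pXn2r// nnegrE ltW.
Qed.

Lemma cvg_gauss_weight m (x : T m) :
  gauss_weight j.+1%:R x @[j --> \oo] --> (1 : R).
Proof.
rewrite -[X in _ --> X]expR0; apply: continuous_cvg; first exact: continuous_expR.
rewrite -[X in _ --> X](mulr0 (- \sum_(i < m) tnth x i ^+ 2)).
apply: cvgMr.
apply/cvgrPdist_lt => e e0; near=> j.
rewrite sub0r normrN ger0_norm ?invr_ge0 ?mulrn_wge0 ?sqr_ge0//.
(* The crude bound [2 (j+1)^2 >= j+1] suffices. *)
apply: (@le_lt_trans _ _ j.+1%:R^-1).
  rewrite lef_pV2 ?posrE ?pmulrn_lgt0 ?exprn_gt0//.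
  rewrite -natrX -mulrnA ler_nat muln2 -addnn.
  by rewrite (leq_trans _ (leq_addr _ _))// expnS expn1 leq_pmulr.
near: j; exact: near_infty_natSinv_lt (PosNum e0).
Unshelve. all: by end_near. Qed.

Local Open Scope ereal_scope.

(** The normal density is [normal_peak s] times [normal_fun 0 s] and has integral 1, which
    determines the constant. *)
Lemma integral_normal_fun_gt0 s : s != 0%R ->
  exists2 c : R, (0 < c)%R & \int[lebesgue_measure]_x (normal_fun 0 s x)%:E = c%:E.
Proof.
move=> s0; exists (normal_peak s)^-1%R; first by rewrite invr_gt0 normal_peak_gt0.
have := integral_normal_pdf 0 s.
under eq_integral do rewrite normal_pdfE// EFinM.
rewrite ge0_integralZl//; last 3 first.
- by apply/measurable_EFinP; exact: measurable_normal_fun.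
- by move=> x _; rewrite lee_fin normal_fun_ge0.
- by rewrite lee_fin normal_peak_ge0.
move=> h; have p0 : normal_peak s != 0%R by rewrite gt_eqF// normal_peak_gt0.
set I := \int[_]_x _ in h *.
by rewrite -[LHS]mul1e -(mulVf p0) EFinM -muleA h mule1.
Qed.

(** Finiteness and positivity are what allow this mass to be divided out later. The weight is a
    product over the coordinates; in dimension 0 the measure is a Dirac mass and the weight is 1. *)
Lemma integral_gauss_weight_gt0 s m : s != 0%R ->
  exists2 c : R, (0 < c)%R &
    \int[lebesgue_tuple R m]_x (gauss_weight s x)%:E = c%:E.
Proof.
move=> s0; have [c c0 cE] := integral_normal_fun_gt0 s0.
elim: m => [|m [b b0 bE]].
  exists 1%R => //; rewrite /= integral_dirac// ?diracT ?mul1e.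
    by rewrite /gauss_weight big_ord0 oppr0 mul0r expR0.
  by apply/measurable_EFinP; exact: measurable_gauss_weight.
exists (c * b)%R; first exact: mulr_gt0.
rewrite ge0_integral_lebesgue_tupleS; last 2 first.
- by apply/measurable_EFinP; exact: measurable_gauss_weight.
- by move=> x; rewrite lee_fin gauss_weight_ge0.
under eq_integral.
  move=> x _; under eq_integral do rewrite gauss_weight_cons EFinM /=.
  rewrite ge0_integralZl//=; last 3 first.
  - by apply/measurable_EFinP; exact: measurable_gauss_weight.
  - by move=> t _; rewrite lee_fin gauss_weight_ge0.
  - by rewrite lee_fin normal_fun_ge0.
  rewrite bE; over.
rewrite ge0_integralZr ?cE//.
- by apply/measurable_EFinP; exact: measurable_normal_fun.
- by move=> x _; rewrite lee_fin normal_fun_ge0.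
- by rewrite lee_fin ltW.
Qed.

End gauss_weight.

(** * Orthogonal splitting of a Euclidean space *)

Section orthonormal_basis.
Variables (R : realType) (n : nat).
Implicit Types (W : {vspace 'rV[R]_n}) (u v : 'rV[R]_n).

Lemma dotv_eq0 u : (dotv u u == 0) = (u == 0).
Proof.
apply/eqP/eqP => [u0|->]; last by rewrite linear0l.
apply/eqP/negPn/negP => un0.
have : 0 < dotv u u by exact: neq0_dnorm_gt0.
by rewrite u0 ltxx.
Qed.

Lemma dotv_sumsq u : dotv u u = \sum_(i < n) u 0 i ^+ 2.
Proof. by rewrite /dotv mxE; apply: eq_bigr => i _; rewrite mxE expr2. Qed.

Lemma dotvC u v : dotv u v = dotv v u.
Proof. by rewrite hermC expr0 mul1r. Qed.

Lemma orthonormal_dotv (s : seq 'rV[R]_n) i j : orthonormal (@dotv R n) s ->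
  (i < size s)%N -> (j < size s)%N -> dotv s`_i s`_j = (i == j)%:R.
Proof.
rewrite /orthonormal; elim: s i j => [//|u s IH] i j /=.
move=> /andP[/andP[/eqP u1 s1]]; rewrite andbT => /andP[/allP us ps].
case: i j => [|i] [|j]//= si sj.
- by apply/eqP/us/mem_nth.
- by rewrite dotvC; apply/eqP/us/mem_nth.
- by rewrite IH// s1 ps.
Qed.

Lemma orthonormal_free (s : seq 'rV[R]_n) : orthonormal (@dotv R n) s -> free s.
Proof.
move=> os; rewrite -[s]in_tupleE; apply/freeP => c c0 i.
have := congr1 (fun w => dotv w s`_i) c0.
rewrite linear0l linear_sumlz (bigD1 i)//= big1 ?addr0 => [|j ji].
  by rewrite linearZl_LR/= orthonormal_dotv// eqxx mulr1.
by rewrite linearZl_LR/= orthonormal_dotv// val_eqE (negbTE ji) mulr0.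
Qed.

(** Gram-Schmidt in recursive form: normalise a nonzero vector of [W], then continue in its
    orthogonal complement inside [W]. *)
Lemma exists_orthonormal_basis W :
  exists b : (\dim W).-tuple 'rV[R]_n, basis_of W b && orthonormal (@dotv R n) b.
Proof.
suff [s [/eqP ss sW os]] :
    exists s, [/\ size s = \dim W, basis_of W s & orthonormal (@dotv R n) s].
  by exists (Tuple ss); rewrite sW.
move: {2}(\dim W) (erefl (\dim W)) => d; elim: d W => [|d IH] W dW.
  exists [::]; split => //; rewrite basisEdim/= dW leqnn andbT.
  by move/eqP : dW; rewrite dimv_eq0 => /eqP ->; rewrite sub0v.
have W0 : W != 0%VS by rewrite -dimv_eq0 dW.
have v0 : vpick W != 0 by rewrite vpick0.
set v := vpick W in v0.
pose u := (Num.sqrt (dotv v v))^-1 *: v.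
have vv0 : 0 < dotv v v by exact: neq0_dnorm_gt0.
have u1 : dotv u u = 1.
  rewrite linearZl_LR linearZr_LR/= mulrA -invfM -expr2 sqr_sqrtr ?ltW//.
  by rewrite mulVf// gt_eqF.
have uW : u \in W by rewrite memvZ// memv_pick.
(* As [dotv u u = 1], [u] is not orthogonal to [W], so cutting [W] with the hyperplane orthogonal to
   [u] lowers the dimension by exactly one. *)
have uNW : u \notin orthov (@dotv R n) W.
  by apply/mem_orthovPn; exists u => //=; rewrite u1 oner_eq0.
have dWu := eq_dim_orthov1 uNW.
have /IH : \dim (W :&: orthov (@dotv R n) <[u]>) = d by rewrite -dWu dW.
move=> [s [ss sb so]].
have su w : w \in s -> w \in W /\ dotv w u = 0.
  move=> ws; have := basis_mem sb ws.
  by rewrite memv_cap mem_orthov1 => /andP[-> /eqP].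
have us : orthonormal (@dotv R n) (u :: s).
  move: so; rewrite /orthonormal/= => /andP[-> ->].
  rewrite u1 eqxx/= !andbT; apply/allP => w /su[_ wu] /=.
  by rewrite dotvC wu.
have sus : size (u :: s) = \dim W by rewrite /= ss -dWu dW.
exists (u :: s); split => //.
rewrite basisEfree orthonormal_free// sus leqnn andbT/=.
rewrite span_cons subv_add -memvE uW/=.
by apply/span_subvP => w /su[].
Qed.

(** Existence of an orthonormal basis rules out the default value [vbasis W] in the choice made by
    [onb]. *)
Lemma onbP W : basis_of W (onb W) && orthonormal (@dotv R n) (onb W).
Proof.
rewrite /onb; case: xgetP => [b _ //|].
by have [b bP] := exists_orthonormal_basis W => /(_ b).
Qed.

Lemma onb_dotv W i j : dotv (tnth (onb W) i) (tnth (onb W) j) = (i == j)%:R.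
Proof.
have /andP[_ o] := onbP W.
by rewrite !(tnth_nth 0) orthonormal_dotv// size_tuple.
Qed.

Lemma onb_mem W i : tnth (onb W) i \in W.
Proof. by have /andP[b _] := onbP W; apply: (basis_mem b); exact: mem_tnth. Qed.

Lemma capv_orthc W : (W :&: orthc W)%VS = 0%VS.
Proof.
apply/eqP; rewrite -subv0; apply/subvP => u; rewrite memv_cap memv0 => /andP[uW].
by move=> /mem_orthovP/(_ _ uW)/eqP; rewrite dotv_eq0.
Qed.

Definition onb_comb W (t : 'I_(\dim W) -> R) : 'rV[R]_n :=
  \sum_(i < \dim W) t i *: tnth (onb W) i.

Lemma onb_comb_mem W t : onb_comb (W := W) t \in W.
Proof. by apply: memv_suml => i _; rewrite memvZ// onb_mem. Qed.

Lemma onb_comb_dotv W t i : dotv (onb_comb (W := W) t) (tnth (onb W) i) = t i.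
Proof.
rewrite /onb_comb linear_sumlz (bigD1 i)//= big1 ?addr0 => [|j ji].
  by rewrite linearZl_LR/= onb_dotv eqxx mulr1.
by rewrite linearZl_LR/= onb_dotv (negbTE ji) mulr0.
Qed.

Lemma onb_comb_norm W t :
  dotv (onb_comb (W := W) t) (onb_comb t) = \sum_(i < \dim W) t i ^+ 2.
Proof.
rewrite {2}/onb_comb linear_sumr/=; apply: eq_bigr => i _.
by rewrite linearZr_LR/= onb_comb_dotv.
Qed.

Lemma orthogonal_decomposition W u :
  u - onb_comb (fun i => dotv u (tnth (onb W) i)) \in orthc W.
Proof.
have /andP[b _] := onbP W.
apply/mem_orthovP => v /(coord_basis b) ->.
rewrite linear_sumr big1//= => i _.
by rewrite linearZr_LR/= -tnth_nth linearBl/= onb_comb_dotv subrr mulr0.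
Qed.

Lemma onb_comb_id W u : u \in W ->
  onb_comb (fun i => dotv u (tnth (onb W) i)) = u.
Proof.
move=> uW; apply/esym/eqP; rewrite -subr_eq0 -memv0 -(capv_orthc W) memv_cap.
by rewrite orthogonal_decomposition memvB// onb_comb_mem.
Qed.

Lemma addv_orthc W : (W + orthc W)%VS = fullv.
Proof.
apply/eqP; rewrite eqEsubv subvf/=; apply/subvP => u _.
rewrite -[u](subrK (onb_comb (fun i => dotv u (tnth (onb W) i)))) addrC.
by rewrite memv_add// ?onb_comb_mem// orthogonal_decomposition.
Qed.

Lemma dim_orthc W : \dim (orthc W) = (n - \dim W)%N.
Proof.
have := dimv_disjoint_sum (capv_orthc W).
rewrite addv_orthc dimvf /dim/= mul1n => dimE.
by rewrite -[LHS](addKn (\dim W)) -dimE.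
Qed.

Lemma oproj_add W u v : u \in W -> v \in orthc W -> oproj W (u + v) = u.
Proof.
move=> uW vW; rewrite linearD/= (daddv_pi_id (capv_orthc W) uW).
have cap0 : (orthc W :&: W)%VS = 0%VS by rewrite capvC capv_orthc.
have vWW : v \in (W + orthc W)%VS by rewrite addv_orthc memvf.
(* The two projections of [v] add up to [v], and the one onto [orthc W] is already [v], so the one
   onto [W] vanishes. *)
have := daddv_pi_add (capv_orthc W) vWW.
rewrite (daddv_pi_id cap0 vW) => /(canRL (addrK v)).
by rewrite subrr => ->; rewrite addr0.
Qed.

(** Rests on the inclusion of [W] in its double orthogonal complement. It expresses the projection
    onto the complement of H through that onto H, which defines the topology of the Grassmannian. *)
Lemma oproj_orthc W u : oproj (orthc W) u = u - oproj W u.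
Proof.
have /memv_addP[w wW [w' w'W ->]] : u \in (W + orthc W)%VS by rewrite addv_orthc memvf.
rewrite (oproj_add wW w'W) [X in _ = X - _]addrC addrK addrC oproj_add//.
apply/mem_orthovP => v /mem_orthovP/(_ _ wW) vw.
exact: etrans (dotvC _ _) vw.
Qed.

End orthonormal_basis.

(** * Orthonormal coordinates along a subspace and its complement *)

Section fiber.
Variables (R : realType) (n : nat).
Implicit Types (W : {vspace 'rV[R]_n}).
Local Notation T m := (m.-tuple (measurableTypeR R)).

Definition row_of_tuple (x : T n) : 'rV[R]_n := \row_i tnth x i.

Definition tuple_of_row (u : 'rV[R]_n) : T n := [tuple u 0 i | i < n].

Lemma tuple_of_rowK : cancel tuple_of_row row_of_tuple.
Proof. by move=> u; apply/rowP => i; rewrite mxE tnth_mktuple. Qed.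

Lemma row_of_tupleK : cancel row_of_tuple tuple_of_row.
Proof. by move=> x; apply/eq_from_tnth => i; rewrite tnth_mktuple mxE. Qed.

Lemma tuple_of_rowB u v :
  tuple_sub (tuple_of_row u) (tuple_of_row v) = tuple_of_row (u - v).
Proof.
by apply/eq_from_tnth => i; rewrite tnth_tuple_sub !tnth_mktuple !mxE.
Qed.

Definition point W (t : T (\dim W)) : 'rV[R]_n := onb_comb (tnth t).

Lemma val_subspace_point W (t : T (\dim W)) : val (subspace_point t) = point t.
Proof.
rewrite -[LHS]/(vsval _) /subspace_point linear_sum; apply: eq_bigr => i _.
by rewrite linearZ/= vsprojK// onb_mem.
Qed.

(** The isometry from the product of [W] and its complement onto R^n, in coordinates. The image of
    the product measure under it is to be compared with Lebesgue measure. *)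
Definition orthogonal_sum W (z : T (\dim W) * T (\dim (orthc W))) : T n :=
  tuple_of_row (point z.1 + point z.2).

Lemma measurable_orthogonal_sum W : measurable_fun setT (@orthogonal_sum W).
Proof.
have mpoint d (Y : measurableType d) V (f : Y -> T (\dim V)) i :
    measurable_fun setT f -> measurable_fun setT (fun y => point (f y) 0 i).
  move=> mf; rewrite (_ : (fun _ => _) = (fun y =>
      \sum_(j < \dim V) tnth (f y) j * tnth (onb V) j 0 i)); last first.
    by apply/funext => y; rewrite summxE; apply: eq_bigr => j _; rewrite mxE.
  apply: measurable_sum => j; apply: measurable_funM => //.
  exact: (measurableT_comp (measurable_tnth (T := measurableTypeR R) j)).
apply/measurable_fun_tnthP => i.
rewrite (_ : _ \o _ = (fun z => point z.1 0 i + point z.2 0 i)); last first.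
  by apply/funext => z /=; rewrite tnth_mktuple mxE.
by apply: measurable_funD; exact: mpoint.
Qed.

Lemma orthogonal_sum_sub W (z z' : T (\dim W) * T (\dim (orthc W))) :
  tuple_sub (orthogonal_sum z) (orthogonal_sum z') =
  orthogonal_sum (tuple_sub z.1 z'.1, tuple_sub z.2 z'.2).
Proof.
have pointB V (s t : T (\dim V)) : point (tuple_sub s t) = point s - point t.
  rewrite /point /onb_comb -sumrB; apply: eq_bigr => i _.
  by rewrite tnth_tuple_sub scalerBl.
by rewrite /orthogonal_sum tuple_of_rowB !pointB opprD addrACA.
Qed.

(** Lets every reflection of R^n be lifted to a pair of reflections of the two factors. *)
Lemma orthogonal_sum_surj W (a : T n) : exists z, orthogonal_sum (W := W) z = a.
Proof.
have /memv_addP[u uW [v vW uvE]] : row_of_tuple a \in (W + orthc W)%VS.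
  by rewrite addv_orthc memvf.
have h (V : {vspace 'rV[R]_n}) w : w \in V -> exists t : T (\dim V), point t = w.
  move=> wV; exists [tuple dotv w (tnth (onb V) i) | i < \dim V].
  rewrite -[RHS](onb_comb_id wV); apply: eq_bigr => i _.
  by rewrite tnth_mktuple.
have [s su] := h _ _ uW; have [t tv] := h _ _ vW.
by exists (s, t); rewrite /orthogonal_sum su tv -uvE row_of_tupleK.
Qed.

(** Pythagoras in the exponent. *)
Lemma gauss_weight_orthogonal_sum (s : R) W (z : T (\dim W) * T (\dim (orthc W))) :
  gauss_weight s (orthogonal_sum z) = gauss_weight s z.1 * gauss_weight s z.2.
Proof.
suff sumE : \sum_(i < n) tnth (orthogonal_sum z) i ^+ 2 =
    \sum_(i < \dim W) tnth z.1 i ^+ 2 +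
    \sum_(i < \dim (orthc W)) tnth z.2 i ^+ 2.
  by rewrite /gauss_weight sumE opprD mulrDl expRD.
transitivity (dotv (point z.1 + point z.2) (point z.1 + point z.2)).
  by rewrite dotv_sumsq; apply: eq_bigr => i _; rewrite tnth_mktuple.
have orth12 : dotv (point z.1) (point z.2) = 0.
  rewrite dotvC; apply: (mem_orthovP _ _ (onb_comb_mem _)).
  exact: onb_comb_mem.
by rewrite hnormDd//= /point !onb_comb_norm.
Qed.

Lemma oproj_sub_orthogonal_sum W (z : T (\dim W) * T (\dim (orthc W))) :
  oproj_sub W (row_of_tuple (orthogonal_sum z)) = subspace_point z.1.
Proof.
rewrite tuple_of_rowK; apply: val_inj; rewrite val_subspace_point /oproj_sub.
by rewrite oproj_add ?onb_comb_mem//= vsprojK// onb_comb_mem.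
Qed.

End fiber.

(** * Integration along an orthogonal splitting *)

Section gauss_mass.
Variable R : realType.
Local Open Scope ereal_scope.

(** For nonzero [s] the integral is finite and [fine] loses nothing. At [s = 0] the division by zero
    would make the weight constantly 1, whence the condition [s != 0] below. *)
Definition gauss_mass (s : R) m : R :=
  fine (\int[lebesgue_tuple R m]_x (gauss_weight s x)%:E).

Lemma gauss_massE s m : s != 0%R ->
  (gauss_mass s m)%:E = \int[lebesgue_tuple R m]_x (gauss_weight s x)%:E.
Proof.
by move=> /(integral_gauss_weight_gt0 m)[c _ cE]; rewrite /gauss_mass cE.
Qed.

Lemma gauss_mass_gt0 s m : s != 0%R -> (0 < gauss_mass s m)%R.
Proof.
by move=> /(integral_gauss_weight_gt0 m)[c c0 cE]; rewrite /gauss_mass cE.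
Qed.

End gauss_mass.

Section product_integral.
Local Open Scope ereal_scope.
Context d1 d2 (T1 : measurableType d1) (T2 : measurableType d2) (R : realType).
Variable m1 : {sigma_finite_measure set T1 -> \bar R}.
Variable m2 : {sigma_finite_measure set T2 -> \bar R}.

Lemma sigma_finite_product : sigma_finite setT (m1 \x m2).
Proof.
have /sigma_finiteP[F [TF ndF Foo]] := sigma_finiteT m1.
have /sigma_finiteP[G [TG ndG Goo]] := sigma_finiteT m2.
exists (fun i => F i `*` G i) => [|i].
  apply/seteqP; split=> // -[x y] _.
  have [i _ Fx] : (\bigcup_i F i) x by rewrite -TF.
  have [j _ Gy] : (\bigcup_i G i) y by rewrite -TG.
  exists (i + j)%N => //; split.
    exact: subsetPset (ndF _ _ (leq_addr j i)) _ Fx.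
  exact: subsetPset (ndG _ _ (leq_addl i j)) _ Gy.
have [[mF Fi] [mG Gi]] := (Foo i, Goo i); split; first exact: measurableX.
by rewrite product_measure1E// lte_mul_pinfty// ge0_fin_numE.
Qed.

(* Packed by hand: canonical inference finds a sigma-finite structure on
   [m1 \x m2] only for subprobabilities. *)
Definition sigma_finite_prod :
    {sigma_finite_measure set (T1 * T2)%type -> \bar R} :=
  HB.pack (m1 \x m2)
    (Measure_isSigmaFinite.Build _ _ _ (m1 \x m2) sigma_finite_product).

Lemma ge0_integral_productM (a : T1 -> \bar R) (b : T2 -> \bar R) :
  measurable_fun setT a -> (forall x, 0 <= a x) ->
  measurable_fun setT b -> (forall x, 0 <= b x) ->
  \int[m1 \x m2]_z (a z.1 * b z.2) = (\int[m1]_x a x) * (\int[m2]_y b y).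
Proof.
move=> ma a0 mb b0; rewrite fubini_tonelli1/=; last 2 first.
- by apply: emeasurable_funM; exact: measurableT_comp.
- by move=> z; rewrite mule_ge0.
rewrite -ge0_integralZr//; last exact: integral_ge0.
by apply: eq_integral => x _; rewrite /fubini_F/= ge0_integralZl.
Qed.

End product_integral.

Section fiber_integral.
Variables (R : realType) (n : nat).
Implicit Types (W : {vspace 'rV[R]_n}).
Local Notation T m := (m.-tuple (measurableTypeR R)).
Local Open Scope ereal_scope.

(** Once [a] is split along [W] and its complement, the reflection at [a] is a product of two
    reflections, and Tonelli treats them one at a time. *)
Lemma orthogonal_sum_reflection W (a : T n) (u : T n -> \bar R) :
  measurable_fun setT u -> (forall x, 0 <= u x) ->
  \int[lebesgue_tuple R (\dim W) \x lebesgue_tuple R (\dim (orthc W))]_z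
    u (tuple_sub a (orthogonal_sum z)) =
  \int[lebesgue_tuple R (\dim W) \x lebesgue_tuple R (\dim (orthc W))]_z
    u (orthogonal_sum z).
Proof.
move=> mu u0; have [[z1 z2] <-] := orthogonal_sum_surj W a.
have muphi : measurable_fun setT (u \o orthogonal_sum (W := W)).
  by apply: measurableT_comp => //; exact: measurable_orthogonal_sum.
rewrite fubini_tonelli1//; last first.
  apply: measurableT_comp => //; apply: measurable_tuple_sub => //.
  exact: measurable_orthogonal_sum.
rewrite fubini_tonelli1//.
rewrite /fubini_F.
rewrite -(ge0_integral_tuple_reflection z1 (f := fun x =>
  \int[lebesgue_tuple R (\dim (orthc W))]_y u (orthogonal_sum (x, y))))//; last 2 first.
- exact: (measurable_fun_fubini_tonelli_F (fun z => u (orthogonal_sum z))).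
- by move=> x; exact: integral_ge0.
apply: eq_integral => x _.
rewrite -(ge0_integral_tuple_reflection z2 (f := fun y =>
  u (orthogonal_sum (tuple_sub z1 x, y))))//; last first.
  exact: (measurableT_comp muphi (pair1_measurable _)).
by apply: eq_integral => y _; rewrite orthogonal_sum_sub.
Qed.

(** The hypothesis lives on R^n, where joint measurability supplies it; restricting to points with
    zero component in [orthc W] transfers it to coordinates of [W]. *)
Lemma measurable_subspace_point W (F : subvs_of W -> \bar R) :
  measurable_fun setT (fun x : T n => F (oproj_sub W (row_of_tuple x))) ->
  measurable_fun setT (fun t : T (\dim W) => F (subspace_point t)).
Proof.
move=> mF; pose o : T (\dim (orthc W)) := [tuple 0%R | i < \dim (orthc W)].
rewrite (_ : (fun _ => _) = (fun x : T n => F (oproj_sub W (row_of_tuple x))) \o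
    orthogonal_sum (W := W) \o pair ^~ o); last first.
  by apply/funext => t /=; rewrite oproj_sub_orthogonal_sum.
apply: measurableT_comp; last exact: pair2_measurable.
by apply: measurableT_comp => //; exact: measurable_orthogonal_sum.
Qed.

(** Lebesgue measure and the image of the product measure are both invariant under reflections,
    hence proportional; the Gaussian itself serves as the second test function. Integrating out the
    complement gives [gauss_mass s q], which cancels and leaves the stated quotient. *)
Lemma fiber_integral (s : R) W (F : subvs_of W -> \bar R) : s != 0%R ->
  (forall z, 0 <= F z) ->
  measurable_fun setT (fun x : T n => F (oproj_sub W (row_of_tuple x))) ->
  \int[lebesgue_tuple R n]_x
    (F (oproj_sub W (row_of_tuple x)) * (gauss_weight s x)%:E) =
  (gauss_mass s n / gauss_mass s (\dim W))%:E *
  \int[lebesgue_tuple R (\dim W)]_t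
    (F (subspace_point t) * (gauss_weight s t)%:E).
Proof.
move=> s0 F0 mF.
have mg m : measurable_fun setT (fun x : T m => (gauss_weight s x)%:E).
  by apply/measurable_EFinP; exact: measurable_gauss_weight.
have mFp := measurable_subspace_point mF.
pose rho := sigma_finite_prod (lebesgue_tuple R (\dim W))
  (lebesgue_tuple R (\dim (orthc W))).
have := reflection_invariant_proportional
  (mu := lebesgue_tuple R n)
  (rho := rho)
  (phi := orthogonal_sum (W := W))
  (f := fun x => F (oproj_sub W (row_of_tuple x)) * (gauss_weight s x)%:E)
  (g := fun x => (gauss_weight s x)%:E)
  (@measurable_orthogonal_sum _ _ _)
  (fun a u => @ge0_integral_tuple_reflection _ _ a u)
  (fun a u => @orthogonal_sum_reflection W a u).
set X := \int[lebesgue_tuple R n]_x _.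
set J := \int[lebesgue_tuple R (\dim W)]_t _.
under eq_integral do rewrite gauss_weight_orthogonal_sum EFinM.
under [X in _ -> _ -> _ -> _ -> _ = X * _]eq_integral do
  rewrite oproj_sub_orthogonal_sum gauss_weight_orthogonal_sum EFinM muleA.
have g0 m (x : T m) : 0 <= (gauss_weight s x)%:E.
  by rewrite lee_fin gauss_weight_ge0.
rewrite (ge0_integral_productM _ _ (mg _) (g0 _) (mg _) (g0 _)).
rewrite (ge0_integral_productM _ _
  (a := fun t => F (subspace_point t) * (gauss_weight s t)%:E) _ _ (mg _) (g0 _))
  -/J -?gauss_massE//; last 2 first.
- exact: (emeasurable_funM mFp (mg _)).
- by move=> x; rewrite mule_ge0.
move=> /(_ (emeasurable_funM mF (mg n)) (fun x => mule_ge0 (F0 _) (g0 _ x))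
  (mg n) (g0 n)) XE.
set p := \dim W in J XE *; set q := \dim (orthc W) in XE.
have [Gp Gq] : (0 < gauss_mass s p)%R /\ (0 < gauss_mass s q)%R.
  by split; exact: gauss_mass_gt0.
(* [X] may be infinite, so the cancellation goes through a finite nonzero factor. *)
have : X * (gauss_mass s p * gauss_mass s q)%:E *
    (gauss_mass s p * gauss_mass s q)^-1%:E = X.
  by rewrite -muleA -EFinM divff ?mule1// mulf_neq0// gt_eqF.
rewrite EFinM XE => <-.
rewrite -!muleA -!EFinM [RHS]muleC; congr (J * _%:E).
by field; rewrite !gt_eqF.
Qed.

End fiber_integral.

(** * Joint measurability *)

Section caratheodory.
Variables (R : realType) (n : nat).
Local Notation T m := (m.-tuple (measurableTypeR R)).

Definition cell_index j (x : T n) : {ffun 'I_n -> int} :=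
  [ffun i => Num.floor (tnth x i * j.+1%:R)].

Definition grid_point j (q : {ffun 'I_n -> int}) : 'rV[R]_n :=
  \row_i ((q i)%:~R / j.+1%:R).

Lemma measurable_cell_index j q : measurable (cell_index j @^-1` [set q]).
Proof.
rewrite (_ : _ @^-1` _ = \bigcap_(i in [set: 'I_n])
    ((fun x : T n => tnth x i * j.+1%:R) @^-1`
      `[(q i)%:~R, (q i + 1)%:~R[)); last first.
  apply/seteqP; split => [x /= <- i _ /=|x /= xq].
    by rewrite ffunE in_itv/= floor_le floorD1_gt.
  apply/ffunP => i; rewrite ffunE; apply: floor_def.
  by have := xq i I; rewrite /= in_itv.
apply: fin_bigcap_measurable => // i _; rewrite -[X in measurable X]setTI.
have : measurable_fun setT (fun x : T n => tnth x i * j.+1%:R).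
  by apply: measurable_funM => //; exact: measurable_tnth.
by apply => //; exact: measurable_itv.
Qed.

Lemma cvg_grid_point (x : T n) :
  grid_point j (cell_index j x) @[j --> \oo] --> row_of_tuple x.
Proof.
apply/cvg_ballP => e e0; near=> j.
split => // k i; rewrite !mxE ffunE /ball/=.
set y := tnth x i.
have j0 : 0 < j.+1%:R :> R by [].
have -> : y - (Num.floor (y * j.+1%:R))%:~R / j.+1%:R =
    (y * j.+1%:R - (Num.floor (y * j.+1%:R))%:~R) / j.+1%:R.
  by rewrite mulrBl mulfK// gt_eqF.
rewrite normrM [X in _ * X]gtr0_norm ?invr_gt0//.
apply: (@le_lt_trans _ _ j.+1%:R^-1); last first.
  by near: j; exact: near_infty_natSinv_lt (PosNum e0).
rewrite ler_piMl ?invr_ge0// ger0_norm ?subr_ge0 ?floor_le//.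
by rewrite lerBlDl ltW// -intrD1 floorD1_gt.
Unshelve. all: by end_near. Qed.

(* Rounding the second variable to a grid of mesh 1/(j+1) turns [f] into a
   countable gluing of functions of the first variable. *)
Lemma caratheodory_measurable d (X : measurableType d) (f : X -> 'rV[R]_n -> R) :
  (forall u, measurable_fun setT (f^~ u)) -> (forall x, continuous (f x)) ->
  measurable_fun setT (fun z : X * T n => f z.1 (row_of_tuple z.2)).
Proof.
move=> mf cf.
apply: (measurable_fun_cvg
  (h := fun j z => f z.1 (grid_point j (cell_index j z.2)))) => [j|[x t] _].
  move=> _ A mA; rewrite setTI.
  (* One measurable rectangle for each cell [q]; there are countably many cells. *)
  rewrite (_ : _ @^-1` A = \bigcup_(q : {ffun 'I_n -> int})
    ((f^~ (grid_point j q)) @^-1` A `*` cell_index j @^-1` [set q])).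
    apply: countable_bigcupT_measurable => // q; apply: measurableX.
      by rewrite -[X in measurable X]setTI; exact: mf.
    exact: measurable_cell_index.
  apply/seteqP; split => [[x t] /= Af|[x t] [q _ [/= Af qE]]].
    by exists (cell_index j t).
  by rewrite qE.
by apply: continuous_cvg; [exact: cf|exact: cvg_grid_point].
Qed.

End caratheodory.

(** * Continuity and measurability of the affine subspace through a point *)

Section affine_point.
Variables (R : realType) (n k : nat).
Local Notation Gr := (grassmannian R n k).

Lemma continuous_grassmannian_measurable (f : Gr -> R) :
  continuous f -> measurable_fun setT f.
Proof.
move=> /continuousP cf; apply: (measurability _ (RGenOpens.measurableE R)).
move=> _ [_ [a [b ->] <-]]; rewrite setTI; apply: sub_sigma_algebra.
exact/cf/interval_open.
Qed.

(** A neighbourhood of a matrix contains a box of neighbourhoods of its finitely many entries. *)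
Lemma continuous_mx (X : topologicalType) p q (f : X -> 'M[R]_(p, q)) :
  (forall i j, continuous (fun x => f x i j)) -> continuous f.
Proof.
move=> cf x A [P MP sPA]; rewrite /nbhs/=.
have : \forall y \near x, forall i j, P i j (f y i j).
  by apply: filter_forall => i; apply: filter_forall => j; exact/cf/MP.
by apply: filterS => y; exact: sPA.
Qed.

Lemma continuous_mulmx (X : topologicalType) p q r
    (f : X -> 'M[R]_(p, q)) (g : X -> 'M[R]_(q, r)) :
  continuous f -> continuous g -> continuous (fun x => f x *m g x).
Proof.
move=> cf cg; apply: continuous_mx => i j.
rewrite (_ : (fun x => _) = (fun x => \sum_l f x i l * g x l j)); last first.
  by apply/funext => x; rewrite mxE.
apply: continuous_big => [|l _].
  exact: (@add_continuous R^o).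
move=> x; apply: cvgM => /=.
  apply: (@continuous_comp _ _ _ f (fun M : 'M[R]_(p, q) => M i l)).
    exact: cf.
  exact: coord_continuous.
apply: (@continuous_comp _ _ _ g (fun M : 'M[R]_(q, r) => M l j)).
  exact: cg.
exact: coord_continuous.
Qed.

Definition affine_through (H : Gr) (u : 'rV[R]_n) : affine_grassmannian R n k :=
  affine_sub (oproj_sub (orthc (val H)) u).

Lemma set_val_affine_through H u :
  set_val (affine_through H u) = (H, u - u *m grassmannian_proj H).
Proof.
transitivity (H, vsval (oproj_sub (orthc (val H)) u)) => //.
rewrite /oproj_sub vsprojK; last exact: memv_pi.
by rewrite oproj_orthc /grassmannian_proj mul_rV_lin1.
Qed.

(** Both topologies are induced: continuity into the affine Grassmannian is tested after [set_val],
    and [grassmannian_proj] is continuous by the choice of topology on the Grassmannian. *)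
Lemma continuous_affine_through (X : topologicalType) (H : X -> Gr)
    (u : X -> 'rV[R]_n) :
  continuous H -> continuous u -> continuous (fun x => affine_through (H x) (u x)).
Proof.
move=> cH cu; apply: (@continuous_comp_initial _ _ _ set_val).
rewrite (_ : _ \o _ =
    (fun x => (H x, u x - u x *m grassmannian_proj (H x)))); last first.
  by apply/funext => x; exact: set_val_affine_through.
have cP : continuous (fun x => grassmannian_proj (H x)).
  move=> x; apply: (@continuous_comp _ _ _ H (@grassmannian_proj R n k)).
    exact: cH.
  exact: initial_continuous.
have cv : continuous (fun x => u x - u x *m grassmannian_proj (H x)).
  move=> x; apply: cvgB; first exact: cu.
  exact: (continuous_mulmx cu cP).
by move=> x; exact: (cvg_pair (cH x) (cv x)).
Qed.

(** Tonelli requires measurability for the product sigma-algebra. Measurability in H for a fixed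
    point and continuity in the point for fixed H provide it. *)
Lemma measurable_affine_through (g : affine_grassmannian R n k -> R) :
  continuous g ->
  measurable_fun setT (fun z : Gr * n.-tuple (measurableTypeR R) =>
    g (affine_through z.1 (row_of_tuple z.2))).
Proof.
move=> cg.
apply: (caratheodory_measurable (f := fun H u => g (affine_through H u))) => [u|H].
  apply: continuous_grassmannian_measurable => H.
  apply: (@continuous_comp _ _ _ (affine_through^~ u) g); last exact: cg.
  apply: (continuous_affine_through (H := id) (u := cst u)) => y.
    exact: cvg_id.
  exact: cst_continuous.
move=> u; apply: (@continuous_comp _ _ _ (affine_through H) g); last exact: cg.
apply: (continuous_affine_through (H := cst H) (u := id)) => y.
  exact: cst_continuous.
exact: cvg_id.
Qed.

End affine_point.

(** * Gaussian approximation of the norm *)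

Section gauss_L1.
Variables (R : realType) (n k : nat).
Hypothesis lekn : (k <= n)%N.
Local Notation Gr := (grassmannian R n k).
Local Notation T m := (m.-tuple (measurableTypeR R)).
Variable nu : {sigma_finite_measure set Gr -> \bar R}.
Variable g : affine_grassmannian R n k -> R.
Hypotheses (g_ge0 : forall p, 0 <= g p) (g_cont : continuous g).
Local Open Scope ereal_scope.

(** The inner integral of [L1_norm], damped by the Gaussian. Coordinates in an orthonormal basis
    preserve the norm, so the weight may be evaluated at [t]. *)
Definition gauss_fiber (s : R) (H : Gr) : \bar R :=
  \int[lebesgue_tuple R (\dim (orthc (val H)))]_t
    ((g (affine_sub (subspace_point t)))%:E * (gauss_weight s t)%:E).

Lemma gauss_fiber_ge0 s (H : Gr) : 0 <= gauss_fiber s H.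
Proof.
by apply: integral_ge0 => t _; rewrite mule_ge0// lee_fin ?gauss_weight_ge0.
Qed.

Let mg : measurable_fun setT (fun z : Gr * T n =>
  (g (affine_through z.1 (row_of_tuple z.2)))%:E).
Proof.
by apply/measurable_EFinP; apply: measurable_affine_through; exact: g_cont.
Qed.

Let mgw s : measurable_fun setT (fun z : Gr * T n =>
  (g (affine_through z.1 (row_of_tuple z.2)))%:E * (gauss_weight s z.2)%:E).
Proof.
apply: emeasurable_funM => //; apply/measurable_EFinP.
apply: (measurableT_comp (measurable_gauss_weight s (m := n))) => //.
Qed.

Let mgH (H : Gr) : measurable_fun setT (fun x : T n =>
  (g (affine_sub (oproj_sub (orthc (val H)) (row_of_tuple x))))%:E).
Proof.
exact: (measurableT_comp mg (pair1_measurable H)).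
Qed.

Let mgt s (H : Gr) : measurable_fun setT (fun t : T (\dim (orthc (val H))) =>
  (g (affine_sub (subspace_point t)))%:E * (gauss_weight s t)%:E).
Proof.
apply: emeasurable_funM.
  exact: (measurable_subspace_point (F := fun z => (g (affine_sub z))%:E)).
by apply/measurable_EFinP; exact: measurable_gauss_weight.
Qed.

(** The constant depends on [H] only through the dimension of its complement, which is [k] because
    [k <= n]; it is therefore the same for all [H]. *)
Lemma gauss_fiberE s (H : Gr) : s != 0%R ->
  \int[lebesgue_tuple R n]_x
    ((g (affine_through H (row_of_tuple x)))%:E * (gauss_weight s x)%:E) =
  (gauss_mass s n / gauss_mass s k)%:E * gauss_fiber s H.
Proof.
move=> s0; have dimE : \dim (orthc (val H)) = k.
  by rewrite dim_orthc (eqP (valP H)) subKn.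
have -> : gauss_mass s k = gauss_mass s (\dim (orthc (val H))) by rewrite dimE.
apply: (fiber_integral (F := fun z => (g (affine_sub z))%:E) s0) => [z|].
  by rewrite lee_fin.
exact: mgH.
Qed.

(** The coordinates in [gauss_fiber] depend on a basis chosen separately for each [H], which hides
    the regularity in [H]. Rewritten as a multiple of an integral over the fixed space R^n, the
    function is measurable by Tonelli. *)
Lemma measurable_gauss_fiber s : s != 0%R -> measurable_fun setT (gauss_fiber s).
Proof.
move=> s0; have [Gn Gk] : (0 < gauss_mass s n)%R /\ (0 < gauss_mass s k)%R.
  by split; exact: gauss_mass_gt0.
rewrite (_ : gauss_fiber s = (fun H => (gauss_mass s k / gauss_mass s n)%:E *
  \int[lebesgue_tuple R n]_x
    ((g (affine_through H (row_of_tuple x)))%:E * (gauss_weight s x)%:E))).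
  apply: emeasurable_funM => //.
  apply: (measurable_fun_fubini_tonelli_F (fun z : Gr * T n =>
    (g (affine_through z.1 (row_of_tuple z.2)))%:E * (gauss_weight s z.2)%:E)) => //.
  by move=> z; rewrite mule_ge0// lee_fin ?gauss_weight_ge0.
apply/funext => H; rewrite gauss_fiberE// muleA -EFinM.
by rewrite mulrA divfK ?divff ?mul1e// gt_eqF.
Qed.

Lemma dual_radon_ge0 x : 0 <= dual_radon nu g x.
Proof. by apply: integral_ge0 => H _; rewrite lee_fin. Qed.

Lemma measurable_dual_radon :
  measurable_fun setT (fun x : T n => dual_radon nu g (row_of_tuple x)).
Proof. by apply: (measurable_fun_fubini_tonelli_G _ mg) => z; rewrite lee_fin. Qed.

Lemma gauss_dual_radon s : s != 0%R ->
  \int[lebesgue_tuple R n]_x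
    (dual_radon nu g (row_of_tuple x) * (gauss_weight s x)%:E) =
  (gauss_mass s n / gauss_mass s k)%:E * \int[nu]_H gauss_fiber s H.
Proof.
move=> s0.
transitivity (\int[lebesgue_tuple R n]_x \int[nu]_H
    ((g (affine_through H (row_of_tuple x)))%:E * (gauss_weight s x)%:E)).
  apply: eq_integral => x _; rewrite ge0_integralZr//.
  - exact: (measurableT_comp mg (pair2_measurable x)).
  - by move=> H _; rewrite lee_fin.
  - by rewrite lee_fin gauss_weight_ge0.
rewrite -(fubini_tonelli (fun z : Gr * T n =>
    (g (affine_through z.1 (row_of_tuple z.2)))%:E * (gauss_weight s z.2)%:E))//;
  last by move=> z; rewrite mule_ge0// lee_fin ?gauss_weight_ge0.
under eq_integral do rewrite gauss_fiberE//.
rewrite ge0_integralZl//.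
- exact: measurable_gauss_fiber.
- by move=> H _; exact: gauss_fiber_ge0.
- by rewrite lee_fin divr_ge0// ltW// gauss_mass_gt0.
Qed.

(** Monotone convergence inside one fiber. The scales are [j.+1], so that [s] is never 0. *)
Lemma cvg_gauss_fiber (H : Gr) :
  gauss_fiber j.+1%:R H @[j --> \oo] -->
  subspace_integral (fun z : subvs_of (orthc (val H)) => `|g (affine_sub z)|%:E).
Proof.
have -> : subspace_integral
      (fun z : subvs_of (orthc (val H)) => `|g (affine_sub z)|%:E) =
    \int[lebesgue_tuple R (\dim (orthc (val H)))]_t
      limn (fun j =>
        (g (affine_sub (subspace_point t)))%:E * (gauss_weight j.+1%:R t)%:E).
  apply: eq_integral => t _; apply/esym/cvg_lim => //.
  rewrite ger0_norm// -[X in _ --> X]mule1.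
  by apply: cvgeZl => //; apply: cvg_EFin; [exact: nearW|exact: cvg_gauss_weight].
apply: cvg_monotone_convergence => //.
- by move=> j; exact: mgt.
- by move=> j t _; rewrite mule_ge0// lee_fin ?gauss_weight_ge0.
- move=> t _ i j ij; rewrite lee_wpmul2l ?lee_fin//.
  by rewrite le_gauss_weight// ler_nat ltnS.
Qed.

Lemma nondecreasing_gauss_fiber (H : Gr) :
  nondecreasing_seq (fun j => gauss_fiber j.+1%:R H).
Proof.
move=> i j ij; apply: ge0_le_integral => //.
- by move=> t _; rewrite mule_ge0// lee_fin ?gauss_weight_ge0.
- exact: mgt.
- exact: mgt.
- move=> t _; rewrite lee_wpmul2l ?lee_fin//.
  by rewrite le_gauss_weight// ler_nat ltnS.
Qed.

(** A second monotone convergence, now over the Grassmannian. *)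
Lemma cvg_integral_gauss_fiber :
  \int[nu]_H gauss_fiber j.+1%:R H @[j --> \oo] --> L1_norm nu g.
Proof.
have -> : L1_norm nu g = \int[nu]_H limn (fun j => gauss_fiber j.+1%:R H).
  by apply: eq_integral => H _; apply/esym/cvg_lim => //; exact: cvg_gauss_fiber.
apply: cvg_monotone_convergence; first exact: measurableT.
- by move=> j; exact: measurable_gauss_fiber.
- by move=> j H _; exact: gauss_fiber_ge0.
- by move=> H _; exact: nondecreasing_gauss_fiber.
Qed.

End gauss_L1.

(** * Comparison of the two norms through each Gaussian scale *)

Lemma le_L1_norm (R : realType) (n k : nat)
    (nu : {sigma_finite_measure set (grassmannian R n k) -> \bar R})
    (g h : affine_grassmannian R n k -> R) :
  (k <= n)%N -> (forall p, 0 <= g p) -> (forall p, 0 <= h p) ->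
  continuous g -> continuous h ->
  (forall x : 'rV[R]_n, (dual_radon nu g x <= dual_radon nu h x)%E) ->
  (L1_norm nu g <= L1_norm nu h)%E.
Proof.
move=> lekn g0 h0 cg ch le_gh.
have gE := cvg_integral_gauss_fiber lekn (nu := nu) g0 cg.
have hE := cvg_integral_gauss_fiber lekn (nu := nu) h0 ch.
rewrite -(cvg_lim (@ereal_hausdorff R) gE) -(cvg_lim (@ereal_hausdorff R) hE).
apply: lee_lim; [exact: cvgP gE|exact: cvgP hE|apply: nearW => j].
have s0 : j.+1%:R != 0 :> R by [].
(* The factor common to [g] and [h]; being positive and finite, it cancels in an inequality between
   extended reals. *)
pose c : R := gauss_mass j.+1%:R n / gauss_mass j.+1%:R k.
have c0 : (0 < c%:E)%E by rewrite lte_fin divr_gt0// gauss_mass_gt0.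
have cfin : c%:E \is a fin_num by [].
have mw : measurable_fun setT (fun x : n.-tuple (measurableTypeR R) =>
    (gauss_weight j.+1%:R x)%:E).
  by apply/measurable_EFinP; exact: measurable_gauss_weight.
have : (\int[lebesgue_tuple R n]_x
      (dual_radon nu g (row_of_tuple x) * (gauss_weight j.+1%:R x)%:E) <=
    \int[lebesgue_tuple R n]_x
      (dual_radon nu h (row_of_tuple x) * (gauss_weight j.+1%:R x)%:E))%E.
  apply: ge0_le_integral; first exact: measurableT.
  - by move=> x _; rewrite mule_ge0 ?dual_radon_ge0// lee_fin gauss_weight_ge0.
  - exact: (emeasurable_funM (measurable_dual_radon nu g0 cg) mw).
  - exact: (emeasurable_funM (measurable_dual_radon nu h0 ch) mw).
  - by move=> x _; rewrite lee_wpmul2r// lee_fin gauss_weight_ge0.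
rewrite (gauss_dual_radon lekn nu g0 cg s0) (gauss_dual_radon lekn nu h0 ch s0).
by rewrite (lee_pmul2l cfin c0).
Qed.

Theorem proposition4p1 (R : realType) (n k : nat) (k_gt0 : (0 < k)%N)
    (ltkn : (k < n)%N)
    (nu : {measure set (grassmannian R n k) -> \bar R})
    (nu_haar : haar_measure nu)
    (g h : affine_grassmannian R n k -> R)
    (g_ge0 : forall p, 0 <= g p) (h_ge0 : forall p, 0 <= h p)
    (g_cont : continuous g) (h_cont : continuous h)
    (g_L1 : (L1_norm nu g < +oo)%E) (h_L1 : (L1_norm nu h < +oo)%E)
    (le_gh : forall x : 'rV[R]_n, (dual_radon nu g x <= dual_radon nu h x)%E) :
  (L1_norm nu g <= L1_norm nu h)%E.
Proof.
(* The prescribed total mass is a real number, so [nu] is finite, hence sigma-finite as Tonelli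
   demands. *)
have nu_fin : fin_num_fun nu.
  by apply: lty_fin_num_fun; rewrite nu_haar.2 ltry.
pose Gr := grassmannian R n k.
have nu_sigma : sigma_finite [set: Gr] nu.
  by apply: fin_num_fun_sigma_finite => //; rewrite measure0.
pose mu : {sigma_finite_measure set Gr -> \bar R} :=
  HB.pack_for (SigmaFiniteMeasure.type Gr R) (Measure.sort nu)
    (isSFinite.Build _ Gr R nu (sfinite_measure_sigma_finite nu_sigma))
    (isSigmaFinite.Build _ Gr R nu nu_sigma).
exact: (le_L1_norm (nu := mu) (ltnW ltkn)).
Qed.
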